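(* Let $S$ be a semidomain. Then the following statements are equivalent: (1) $S$ is a Prüfer semiring. (2) For any prime ideal $\mathfrak p$ of $S$, $S_{\mathfrak p}$ is a valuation semidomain. (3) For any maximal ideal $\mathfrak m$ of $S$, $S_{\mathfrak m}$ is a valuation semidomain.
   Context: A semiring is a set $S$ with operations $+,\cdot$ such that $(S,+)$ is a commutative monoid with identity $0$, $(S,\cdot)$ is a commutative monoid with identity $1\neq 0$, multiplication distributes over addition, and $s\cdot 0=0$ for all $s\in S$. An ideal of $S$ is a nonempty subset $I\subseteq S$ such that $a,b\in I$ and $s\in S$ imply $a+b, sa\in I$. An ideal $P\neq S$ is prime if $ab\in P$ implies $a\in P$ or $b\in P$; a maximal ideal is an ideal maximal among the ideals $\neq S$ (maximal ideals are prime). An element $s\in S$ is multiplicatively cancellable (MC) if $sb=sc$ implies $b=c$ for all $b,c\in S$; $S$ is a semidomain if every nonzero element of $S$ is MC. A semidomain is a valuation semidomain if its ideals are totally ordered by inclusion. Localization: for a multiplicatively closed set $T\subseteq S$, $S_T$ is the set of equivalence classes $a/b$ of pairs $(a,b)\in S\times T$ under $(a,b)\sim(c,d)$ iff $tad=tbc$ for some $t\in T$, with $a/b+c/d=(ad+bc)/(bd)$ and $(a/b)(c/d)=(ac)/(bd)$. For a prime ideal $\mathfrak p$, $S_{\mathfrak p}$ denotes $S_T$ with $T=S-\mathfrak p$. The total quotient semiring $Q(S)$ is the localization of $S$ at the set of its MC elements, and $S$ is viewed inside $Q(S)$ via $s\mapsto s/1$. A fractional ideal of $S$ is a nonempty subset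 $I\subseteq Q(S)$ closed under addition and under multiplication by elements of $S$, such that $dI\subseteq S$ for some MC element $d\in S$. The product of fractional ideals is $IJ=\{a_1b_1+\cdots+a_nb_n: a_i\in I,\ b_i\in J\}$. A fractional ideal (in particular an ideal) $I$ of $S$ is invertible if $IJ=S$ for some fractional ideal $J$ of $S$. A semiring $S$ is a Prüfer semiring if every nonzero finitely generated ideal of $S$ is invertible. *)

(* Defs.v *)
From HB Require Import structures.
From mathcomp Require Import all_boot all_order all_algebra generic_quotient.
From mathcomp Require Import boolp classical_sets.
From mathcomp Require Import ring.

Set Implicit Arguments.
Unset Strict Implicit.
Unset Printing Implicit Defensive.

Import GRing.Theory.

Local Open Scope classical_set_scope.
Local Open Scope quotient_scope.
Local Open Scope ring_scope.

(* Semirings are of type comNzSemiRingType: commutative, with 1 != 0; an       *)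
(* element s is multiplicatively cancellable when GRing.lreg s.               *)

Section Ideals.
Variable S : comNzSemiRingType.
Implicit Types I J P : set S.

Definition is_ideal I : Prop :=
  [/\ I !=set0,
      forall a b, I a -> I b -> I (a + b)
    & forall s a, I a -> I (s * a)].

Definition is_prime P : Prop :=
  [/\ is_ideal P, P <> setT & forall a b, P (a * b) -> P a \/ P b].

Definition is_maximal P : Prop :=
  [/\ is_ideal P, P <> setT
    & forall J, is_ideal J -> J <> setT -> P `<=` J -> J = P].

Definition is_finitely_generated I : Prop :=
  exists g : seq S, I = smallest is_ideal [set` g].

Definition is_semidomain : Prop := forall s : S, s != 0 -> GRing.lreg s.

Definition is_valuation_semidomain : Prop :=
  is_semidomain /\
  forall I J, is_ideal I -> is_ideal J -> I `<=` J \/ J `<=` I.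

Lemma ideal0 I : is_ideal I -> I 0.
Proof. by case=> [[a Ia] _ IM]; rewrite -(mul0r a); apply: IM. Qed.

Lemma ideal1 I : is_ideal I -> I 1 -> I = setT.
Proof.
case=> _ _ IM I1; apply/seteqP; split=> // x _.
by rewrite -[x]mulr1; apply: IM.
Qed.

Lemma maximal_prime P : is_maximal P -> is_prime P.
Proof.
case=> idP PT Pmax; split=> // a b Pab; case: (pselect (P a)) => [|nPa]; first by left.
right; have [_ PD PM] := idP.
pose J := [set x | exists y s, P y /\ x = y + s * a].
have idJ : is_ideal J.
  split.
  - by exists 0, 0, 0; split; [exact: ideal0 | rewrite mul0r addr0].
  - move=> _ _ [y [s [Py ->]]] [z [t [Pz ->]]].
    by exists (y + z), (s + t); split; [exact: PD | rewrite mulrDl addrACA].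
  - move=> t _ [y [s [Py ->]]].
    by exists (t * y), (t * s); split; [exact: PM | rewrite mulrDr mulrA].
have PJ : P `<=` J by move=> x Px; exists x, 0; split=> //; rewrite mul0r addr0.
have Ja : J a by exists 0, 1; split; [exact: ideal0 | rewrite mul1r add0r].
have JT : J = setT.
  by apply: contrapT => nJT; apply: nPa; rewrite -(Pmax J idJ nJT PJ).
have [y [s [Py e1]]] : J 1 by rewrite JT.
rewrite -[b]mul1r e1 mulrDl -mulrA; apply: PD; last exact: PM.
by rewrite mulrC; apply: PM.
Qed.

End Ideals.

(* Excluding 0 is what makes 1 != 0 hold in the localization.                 *)
Record mulSet (S : comNzSemiRingType) := MulSet {
  mset : set S;
  mulSet0 : ~ mset 0;
  mulSet1 : mset 1;
  mulSetM : forall a b, mset a -> mset b -> mset (a * b)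
}.

Section Localization.
Variables (S : comNzSemiRingType) (T : mulSet S).

Let pairs : choiceType := (S * set_type (mset T))%type.
Implicit Types x y : pairs.

Definition loc_rel x y : bool :=
  `[< exists t : S, mset T t /\ t * x.1 * val y.2 = t * val x.2 * y.1 >].

Let memT (t : set_type (mset T)) : mset T (val t).
Proof. by have := valP t; rewrite inE. Qed.

Fact loc_rel_equiv : equiv_class_of loc_rel.
Proof.
split.
- by move=> x; apply/asboolP; exists 1; split; [exact: mulSet1 | ring].
- move=> x y; apply/asboolP/asboolP => -[t [Tt e]]; exists t; split=> //.
    by rewrite -mulrA (mulrC y.1) mulrA -e; ring.
  by rewrite -mulrA (mulrC x.1) mulrA -e; ring.
- move=> y x z /asboolP[t [Tt e1]] /asboolP[s [Ts e2]]; apply/asboolP.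
  exists (t * s * val y.2); split.
    by apply: mulSetM; [exact: mulSetM | exact: memT].
  transitivity (s * val z.2 * (t * x.1 * val y.2)); first by ring.
  rewrite e1; transitivity (t * val x.2 * (s * y.1 * val z.2)); first by ring.
  by rewrite e2; ring.
Qed.

Canonical loc_equiv := EquivRelPack loc_rel_equiv.
Canonical loc_encModRel := defaultEncModRel loc_rel.

Definition localization := {eq_quot loc_rel}.

HB.instance Definition _ := Choice.on localization.
HB.instance Definition _ := EqQuotient.on localization.

Lemma loc_den_subproof (a b : set_type (mset T)) : val a * val b \in mset T.
Proof. by rewrite inE; apply: mulSetM; apply: memT. Qed.

Definition loc_den1 : set_type (mset T) :=
  exist (fun t => t \in mset T) 1 (mem_set (mulSet1 T)).
Definition loc_denM a b : set_type (mset T) :=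
  exist (fun t => t \in mset T) _ (loc_den_subproof a b).

Lemma val_loc_den1 : val loc_den1 = 1. Proof. by []. Qed.

Lemma val_loc_denM a b : val (loc_denM a b) = val a * val b. Proof. by []. Qed.

Let loc_denE := (val_loc_den1, val_loc_denM).

Definition frac (a : S) (b : set_type (mset T)) : localization :=
  \pi_localization (a, b).

Lemma frac_eqP a b c d :
  frac a b = frac c d <->
  exists t, mset T t /\ t * a * val d = t * val b * c.
Proof. by split=> [/eqmodP/asboolP|?]; last apply/eqmodP/asboolP. Qed.

Lemma frac_ind (P : localization -> Prop) :
  (forall a b, P (frac a b)) -> forall z, P z.
Proof. by move=> H x; rewrite -(reprK x); case: (repr x) => a b; exact: H. Qed.

Definition loc_add (x y : localization) : localization :=
  let: (a, b) := repr x in let: (c, d) := repr y in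
  frac (a * val d + val b * c) (loc_denM b d).

Definition loc_mul (x y : localization) : localization :=
  let: (a, b) := repr x in let: (c, d) := repr y in
  frac (a * c) (loc_denM b d).

Let repr_frac a b : frac (repr (frac a b)).1 (repr (frac a b)).2 = frac a b.
Proof. by rewrite /frac -surjective_pairing reprK. Qed.

Let frac_addP (a c a' c' : S) (b d b' d' : set_type (mset T)) :
  frac a' b' = frac a b -> frac c' d' = frac c d ->
  frac (a' * val d' + val b' * c') (loc_denM b' d') =
  frac (a * val d + val b * c) (loc_denM b d).
Proof.
move=> /frac_eqP[t [Tt e1]] /frac_eqP[s [Ts e2]]; apply/frac_eqP.
exists (t * s); split; first exact: mulSetM.
rewrite !loc_denE.
transitivity (t * a' * val b * (s * val d' * val d)
  + s * c' * val d * (t * val b' * val b)); first by ring.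
by rewrite e1 e2; ring.
Qed.

Let frac_mulP (a c a' c' : S) (b d b' d' : set_type (mset T)) :
  frac a' b' = frac a b -> frac c' d' = frac c d ->
  frac (a' * c') (loc_denM b' d') = frac (a * c) (loc_denM b d).
Proof.
move=> /frac_eqP[t [Tt e1]] /frac_eqP[s [Ts e2]]; apply/frac_eqP.
exists (t * s); split; first exact: mulSetM.
rewrite !loc_denE.
transitivity (t * a' * val b * (s * c' * val d)); first by ring.
by rewrite e1 e2; ring.
Qed.

Let loc_addE a b c d :
  loc_add (frac a b) (frac c d) = frac (a * val d + val b * c) (loc_denM b d).
Proof.
rewrite /loc_add; move: (repr_frac a b) (repr_frac c d).
by case: (repr _) => a' b'; case: (repr _) => c' d'; exact: frac_addP.
Qed.

Let loc_mulE a b c d :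
  loc_mul (frac a b) (frac c d) = frac (a * c) (loc_denM b d).
Proof.
rewrite /loc_mul; move: (repr_frac a b) (repr_frac c d).
by case: (repr _) => a' b'; case: (repr _) => c' d'; exact: frac_mulP.
Qed.

Let frac_eq1 a b c d : a * val d = val b * c -> frac a b = frac c d.
Proof.
move=> e; apply/frac_eqP; exists 1; split; first exact: mulSet1.
by rewrite !mul1r.
Qed.

Let loc_addA : associative loc_add.
Proof.
elim/frac_ind=> a b; elim/frac_ind=> c d; elim/frac_ind=> e f.
by rewrite !loc_addE; apply: frac_eq1; rewrite !loc_denE; ring.
Qed.

Let loc_addC : commutative loc_add.
Proof.
elim/frac_ind=> a b; elim/frac_ind=> c d.
by rewrite !loc_addE; apply: frac_eq1; rewrite !loc_denE; ring.
Qed.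

Let loc_add0 : left_id (frac 0 loc_den1) loc_add.
Proof.
elim/frac_ind=> a b.
by rewrite !loc_addE; apply: frac_eq1; rewrite !loc_denE; ring.
Qed.

HB.instance Definition _ :=
  GRing.isNmodule.Build localization loc_addA loc_addC loc_add0.

Let loc_mulA : associative loc_mul.
Proof.
elim/frac_ind=> a b; elim/frac_ind=> c d; elim/frac_ind=> e f.
by rewrite !loc_mulE; apply: frac_eq1; rewrite !loc_denE; ring.
Qed.

Let loc_mulC : commutative loc_mul.
Proof.
elim/frac_ind=> a b; elim/frac_ind=> c d.
by rewrite !loc_mulE; apply: frac_eq1; rewrite !loc_denE; ring.
Qed.

Let loc_mul1 : left_id (frac 1 loc_den1) loc_mul.
Proof.
elim/frac_ind=> a b.
by rewrite !loc_mulE; apply: frac_eq1; rewrite !loc_denE; ring.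
Qed.

Let loc_mulDl : left_distributive loc_mul +%R.
Proof.
elim/frac_ind=> a b; elim/frac_ind=> c d; elim/frac_ind=> e f.
rewrite -[_ + _]/(loc_add _ _) -[RHS]/(loc_add _ _).
by rewrite !(loc_mulE, loc_addE); apply: frac_eq1; rewrite !loc_denE; ring.
Qed.

Let loc_mul0 : left_zero 0 loc_mul.
Proof.
elim/frac_ind=> a b; rewrite -[0]/(frac 0 loc_den1).
by rewrite !loc_mulE; apply: frac_eq1; rewrite !loc_denE; ring.
Qed.

Let loc_1neq0 : frac 1 loc_den1 != 0.
Proof.
apply/eqP => /frac_eqP[t [Tt]]; rewrite !loc_denE mulr0 !mulr1 => t0.
by apply: (@mulSet0 _ T); rewrite -t0.
Qed.

HB.instance Definition _ :=
  GRing.Nmodule_isComNzSemiRing.Build localization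
    loc_mulA loc_mulC loc_mul1 loc_mulDl loc_mul0 loc_1neq0.

Lemma fracD a b c d :
  frac a b + frac c d = frac (a * val d + val b * c) (loc_denM b d).
Proof. exact: loc_addE. Qed.

Lemma fracM a b c d : frac a b * frac c d = frac (a * c) (loc_denM b d).
Proof. exact: loc_mulE. Qed.

Definition to_loc (s : S) : localization := frac s loc_den1.

End Localization.

Section PrimeLocalization.
Variables (S : comNzSemiRingType) (p : set S) (p_prime : is_prime p).

Fact prime_compl0 : ~ (~` p) 0.
Proof. by case: p_prime => /ideal0 p0 _ _; apply. Qed.

Fact prime_compl1 : (~` p) 1.
Proof. by case: p_prime => idp pT _ p1; apply: pT; apply: ideal1. Qed.

Fact prime_complM a b : (~` p) a -> (~` p) b -> (~` p) (a * b).
Proof. by case: p_prime => _ _ pM na nb /pM[]. Qed.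

Definition prime_compl : mulSet S :=
  MulSet prime_compl0 prime_compl1 prime_complM.

Definition loc_at_prime : comNzSemiRingType := localization prime_compl.

End PrimeLocalization.

Section Fractional.
Variable S : comNzSemiRingType.

Fact MC0 : ~ GRing.lreg (0 : S).
Proof. by move=> /lreg_neq0; rewrite eqxx. Qed.

Definition MC : mulSet S :=
  @MulSet S [set s | GRing.lreg s] MC0 (@lreg1 S) (@lregM S).

Definition total_quotient : comNzSemiRingType := localization MC.

Definition in_quot (s : S) : total_quotient := to_loc MC s.

Implicit Types I J : set total_quotient.

Definition is_fractional_ideal I : Prop :=
  [/\ I !=set0,
      forall x y, I x -> I y -> I (x + y),
      forall s x, I x -> I (in_quot s * x)
    & exists2 d : S, GRing.lreg d &
        [set in_quot d * x | x in I] `<=` range in_quot].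

Definition frac_ideal_mul I J : set total_quotient :=
  [set x | exists n (a b : 'I_n.+1 -> total_quotient),
     [/\ forall i, I (a i), forall i, J (b i) & x = \sum_i a i * b i]].

Definition is_invertible I : Prop :=
  is_fractional_ideal I /\
  exists2 J, is_fractional_ideal J & frac_ideal_mul I J = range in_quot.

Definition is_Prufer : Prop :=
  forall I : set S, is_ideal I -> is_finitely_generated I -> I <> [set 0] ->
    is_invertible (in_quot @` I).

Lemma in_quot_inj : injective in_quot.
Proof. by move=> a b /frac_eqP[t [tI]]; rewrite !val_loc_den1 !mulr1 => /tI. Qed.

Lemma in_quotD a b : in_quot (a + b) = in_quot a + in_quot b.
Proof.
rewrite [RHS]fracD; apply/frac_eqP; exists 1.
by split; [exact: lreg1 | rewrite !val_loc_denM !val_loc_den1; ring].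
Qed.

Lemma in_quotM a b : in_quot (a * b) = in_quot a * in_quot b.
Proof.
rewrite [RHS]fracM; apply/frac_eqP; exists 1.
by split; [exact: lreg1 | rewrite !val_loc_denM !val_loc_den1; ring].
Qed.

Lemma ideal_fractional (I : set S) :
  is_ideal I -> is_fractional_ideal (in_quot @` I).
Proof.
case=> -[a Ia] ID IM; split.
- by exists (in_quot a), a.
- move=> _ _ [x Ix <-] [y Iy <-]; exists (x + y); last exact: in_quotD.
  exact: ID.
- by move=> s _ [x Ix <-]; exists (s * x); [exact: IM | exact: in_quotM].
- exists 1; first exact: lreg1.
  by move=> _ [_ [x Ix <-] <-]; exists (1 * x); last exact: in_quotM.
Qed.

End Fractional.

(* Main.v *)
From mathcomp Require Import all_boot all_order all_algebra.
From mathcomp Require Import boolp classical_sets.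
From mathcomp Require Import ring.
Require Import Defs.

(** For [a] and [b] in [S] and a prime [p], [a] divides [b] in the localization
    at [p] exactly when [t * b = r * a] for some [r] and some [t] outside [p].
    The ideals of the localization form a chain iff of any two elements of [S]
    one divides the other in this sense ([loc_ideals_totalP]).  The theorem
    compares this with invertibility.

    If [a] and [b] are not both 0 and the ideal they generate has an inverse
    [K], then [1 = a k + b l] with [k] and [l] in [K].  The elements [a k], [b k], [a l]
    and [b l] all lie in [S], and a prime [p] cannot contain both [a k] and
    [b l].  If it misses [a k], the relation is [(a k) b = (b k) a]; the other
    case is symmetric ([Prufer_loc_total]).

    Conversely, let [I] be generated by [g], not all zero, and let [J] be the
    set of the [x] in the total quotient semiring with [I x] inside [S].  Then
    [I J] is an ideal of [S]; if it were proper, it would lie in a maximal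
    ideal [m] ([maximal_above]).  Since the ideals of the localization at [m]
    form a chain, one generator [a] divides all the others there, and a common
    denominator [s] outside [m] gives [s * b = r * a] for every [b] in [g]
    ([loc_total_generator]).  Hence [s / a] belongs to [J], and
    [s = a (s / a)] belongs to [I J], so to [m]: a contradiction.  Thus [I] is
    invertible ([loc_total_Prufer]).  The argument uses no subtraction, and
    cancels only nonzero factors, which is why it holds for semidomains.  As
    maximal ideals are prime, the two halves close the cycle. *)

Set Implicit Arguments.
Unset Strict Implicit.
Unset Printing Implicit Defensive.

Import GRing.Theory.

Local Open Scope classical_set_scope.
Local Open Scope ring_scope.

(** * Ideals of a semiring *)

Section Ideals.
Variable S : comNzSemiRingType.
Implicit Types I J P : set S.

Definition principal_ideal (a : S) : set S := [set x | exists r, x = r * a].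

Lemma principal_ideal_is_ideal a : is_ideal (principal_ideal a).
Proof.
split.
- by exists a, 1; rewrite mul1r.
- by move=> _ _ [r ->] [s ->]; exists (r + s); rewrite mulrDl.
- by move=> s _ [r ->]; exists (s * r); rewrite mulrA.
Qed.

Lemma set0_is_ideal : is_ideal [set 0 : S].
Proof.
split=> [|a b -> ->|s a ->]; [by exists 0 | exact: addr0 | exact: mulr0].
Qed.

Definition pair_ideal (a b : S) : set S :=
  [set x | exists r s, x = r * a + s * b].

Lemma pair_ideal_is_ideal a b : is_ideal (pair_ideal a b).
Proof.
split.
- by exists 0, 0, 0; rewrite !mul0r addr0.
- move=> _ _ [r [s ->]] [r' [s' ->]]; exists (r + r'), (s + s').
  by ring.
- by move=> t _ [r [s ->]]; exists (t * r), (t * s); ring.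
Qed.

Lemma pair_ideal_l a b : pair_ideal a b a.
Proof. by exists 1, 0; rewrite mul1r mul0r addr0. Qed.

Lemma pair_ideal_r a b : pair_ideal a b b.
Proof. by exists 0, 1; rewrite mul1r mul0r add0r. Qed.

Lemma pair_ideal_finitely_generated a b :
  is_finitely_generated (pair_ideal a b).
Proof.
exists [:: a; b]; apply/seteqP; split.
- move=> _ [r [s ->]] I [[_ ID IM] gI].
  by apply: ID; apply: IM; apply: gI; rewrite /= !inE eqxx ?orbT.
- apply: smallest_sub; first exact: pair_ideal_is_ideal.
  move=> x; rewrite /= !inE => /orP[]/eqP->.
    exact: pair_ideal_l.
  exact: pair_ideal_r.
Qed.

(** Zorn's lemma for unions asks for the empty chain as well, whose union is
    empty and so is no ideal: the order is therefore put on the sets [X] whose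
    union with [I] is a proper ideal. *)
Lemma maximal_above I :
  is_ideal I -> I <> setT -> exists2 m, is_maximal m & I `<=` m.
Proof.
move=> idI IT; pose proper_over X := is_ideal (I `|` X) /\ ~ (I `|` X) 1.
have [|A [[idIA IA1] Amax]] := @Zorn_bigcup S proper_over.
  move=> F FP Ftot; split; last first.
    case=> [I1|[X FX X1]]; first by apply: IT; exact: ideal1.
    by have [_] := FP X FX; apply; right.
  have [[x0 Ix0] ID IM] := idI; split; first by exists x0; left.
  - have sub X : F X -> I `|` X `<=` I `|` \bigcup_(X in F) X.
      by move=> FX x [Ix|Xx]; [left | right; exists X].
    move=> a b [Ia|[X FX Xa]] [Ib|[Y FY Yb]].
    + by left; exact: ID.
    + by apply: (sub Y FY); have [[_ D _] _] := FP Y FY; apply: D;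
        [left | right].
    + by apply: (sub X FX); have [[_ D _] _] := FP X FX; apply: D;
        [right | left].
    + case: (Ftot X Y FX FY) => [XY|YX].
        apply: (sub Y FY); have [[_ D _] _] := FP Y FY.
        by apply: D; right => //; exact: XY.
      apply: (sub X FX); have [[_ D _] _] := FP X FX.
      by apply: D; right => //; exact: YX.
  - move=> s a [Ia|[X FX Xa]]; first by left; exact: IM.
    have [[_ _ M] _] := FP X FX.
    by case: (M s a (or_intror Xa)) => [Isa|Xsa]; [left | right; exists X].
exists (I `|` A); last exact: subsetUl.
split=> // [IAT|J idJ JT IAJ]; first by apply: IA1; rewrite IAT.
apply/seteqP; split=> // x Jx; right; apply: contrapT => nAx.
have IJ : I `|` J = J by apply/setUidPr => y Iy; apply: IAJ; left.
apply: (Amax J).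
  by split=> [y Ay|JA]; [apply: IAJ; right | apply: nAx; exact: JA].
by split; rewrite IJ // => J1; apply: JT; exact: ideal1.
Qed.

End Ideals.

(** * Divisibility in a localization *)

Section Localization.
Variables (S : comNzSemiRingType) (T : mulSet S).

(** Divisibility of [b] by [a] in the localization, with denominators cleared so
    that it speaks of elements of [S] only. *)
Definition loc_dvd (a b : S) : Prop := exists t r, mset T t /\ t * b = r * a.

Definition den (t : S) (Tt : mset T t) : set_type (mset T) :=
  exist (fun x => x \in mset T) t (mem_set Tt).

Lemma val_den t (Tt : mset T t) : val (den Tt) = t. Proof. by []. Qed.

Lemma mset_val (t : set_type (mset T)) : mset T (val t).
Proof. by have := valP t; rewrite inE. Qed.

Lemma loc_dvd_frac a b (u v : set_type (mset T)) :
  loc_dvd a b -> exists z : localization T, frac b v = z * frac a u.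
Proof.
move=> [t [r [Tt e]]]; exists (frac (r * val u) (loc_denM (den Tt) v)).
rewrite fracM; apply/frac_eqP; exists 1; split; first exact: mulSet1.
rewrite !val_loc_denM val_den.
transitivity (t * b * (val u * val v)); first by ring.
by rewrite e; ring.
Qed.

(** Fractions differ from their numerators by units, so comparing the principal
    ideals of elements of [S] is enough.  Conversely, if some [x] in [I] is not
    in [J], then no [y] in [J] divides [x], so [x] divides every such [y]. *)
Lemma loc_ideals_totalP :
  (forall I J : set (localization T), is_ideal I -> is_ideal J ->
     I `<=` J \/ J `<=` I) <->
  (forall a b, loc_dvd a b \/ loc_dvd b a).
Proof.
split=> [tot a b | tot I J [_ _ IM] [_ _ JM]].
  have dvdW c d : principal_ideal (to_loc T d) `<=` principal_ideal (to_loc T c)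
      -> loc_dvd c d.
    move=> /(_ (to_loc T d))[|z]; first by exists 1; rewrite mul1r.
    elim/frac_ind: z => r u; rewrite fracM => /frac_eqP[t [Tt]].
    rewrite !val_loc_denM !val_loc_den1 => e.
    exists (t * val u), (t * r).
    split; first by apply: mulSetM => //; exact: mset_val.
    transitivity (t * d * (val u * 1)); first by ring.
    by rewrite e; ring.
  by case: (tot _ _ (principal_ideal_is_ideal (to_loc T a))
      (principal_ideal_is_ideal (to_loc T b))) => /dvdW; [right | left].
case: (pselect (I `<=` J)) => [|nIJ]; first by left.
have [x Ix nJx] : exists2 x, I x & ~ J x.
  apply: contrapT => h; apply: nIJ => x Ix; apply: contrapT => nJx.
  by apply: h; exists x.
right; elim/frac_ind: x Ix nJx => a u Ix nJx.
elim/frac_ind=> b v Jy.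
case: (tot a b) => [/(@loc_dvd_frac _ _ u v)|/(@loc_dvd_frac _ _ v u)] [z e].
  by rewrite e; exact: IM.
by case: nJx; rewrite e; exact: JM.
Qed.

Lemma loc_semidomain : is_semidomain S -> is_semidomain (localization T).
Proof.
move=> domS; elim/frac_ind=> a u a0.
have ra : GRing.lreg a.
  apply: domS; apply/eqP=> aE; case/eqP: a0; rewrite aE.
  have <- : frac 0 (loc_den1 T) = 0 by [].
  apply/frac_eqP; exists 1.
  by split; [exact: mulSet1 | rewrite !mulr0 mul0r].
have rT t : mset T t -> GRing.lreg t.
  by move=> Tt; apply: domS; apply/eqP=> t0; apply: (@mulSet0 _ T); rewrite -t0.
elim/frac_ind=> b v; elim/frac_ind=> c w.
rewrite !fracM => /frac_eqP[t [Tt]]; rewrite !val_loc_denM => e.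
apply/frac_eqP; exists 1; split; first exact: mulSet1.
apply: (lregM (lregM (rT _ Tt) ra) (rT _ (mset_val u))).
transitivity (t * (a * b) * (val u * val w)); first by ring.
by rewrite e; ring.
Qed.

(** Among finitely many elements, a least one for divisibility divides all the
    others in the localization; the product of the denominators involved is a
    common denominator [s]. *)
Lemma loc_total_generator (x : S) (g : seq S) :
  (forall a b, loc_dvd a b \/ loc_dvd b a) ->
  exists a s, [/\ a \in x :: g, mset T s
    & forall b, b \in x :: g -> exists r, s * b = r * a].
Proof.
move=> tot; elim: g => [|y g [a [s [ag Ts sg]]]].
  exists x, 1; split; [exact: mem_head | exact: mulSet1 |].
  by move=> b; rewrite inE => /eqP->; exists 1.
case: (tot a y) => -[t [r [Tt e]]].
  exists a, (s * t); split; [|exact: mulSetM|].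
    by move: ag; rewrite !inE => /orP[->|->]; rewrite ?orbT.
  move=> b; rewrite !inE orbCA => /orP[/eqP->|bg].
    by exists (s * r); rewrite -mulrA e mulrA.
  have [|r' e'] := sg b; first by rewrite inE.
  by exists (t * r'); rewrite -mulrA (mulrC t) mulrA e'; ring.
exists y, (s * t); split; [by rewrite !inE eqxx orbT | exact: mulSetM |].
move=> b; rewrite !inE orbCA => /orP[/eqP->|bg]; first by exists (s * t).
have [|r' e'] := sg b; first by rewrite inE.
exists (r' * r); rewrite -[RHS]mulrA -e.
transitivity (t * (s * b)); first by ring.
by rewrite e'; ring.
Qed.

End Localization.

(** * Invertible fractional ideals *)

Section Fractional.
Variable S : comNzSemiRingType.
Local Notation Q := (total_quotient S).
Implicit Types (I : set S) (A B : set Q).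

Lemma in_quot0 : in_quot (0 : S) = 0. Proof. by []. Qed.

Lemma frac_ideal_mul1 A B x y : A x -> B y -> frac_ideal_mul A B (x * y).
Proof. by exists 0, (fun=> x), (fun=> y); rewrite big_ord1. Qed.

Lemma frac_ideal_mulD A B x y :
  frac_ideal_mul A B x -> frac_ideal_mul A B y -> frac_ideal_mul A B (x + y).
Proof.
move=> [n [a [b [Aa Bb ->]]]] [m [c [d [Ac Bd ->]]]].
pose cat (f : 'I_n.+1 -> Q) (h : 'I_m.+1 -> Q) (i : 'I_(n.+1 + m.+1)) :=
  match split i with inl j => f j | inr j => h j end.
exists (n + m.+1)%N, (cat a c), (cat b d); split.
- by move=> i; rewrite /cat; case: split.
- by move=> i; rewrite /cat; case: split.
rewrite (@big_split_ord _ _ _ n.+1 m.+1) /=; congr (_ + _);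
  apply: eq_bigr => i _; rewrite /cat.
  by rewrite -[lshift _ _]/(unsplit (inl i)) unsplitK.
by rewrite -[rshift _ _]/(unsplit (inr i)) unsplitK.
Qed.

Lemma frac_ideal_mulZ A B s x :
  (forall s a, A a -> A (in_quot s * a)) ->
  frac_ideal_mul A B x -> frac_ideal_mul A B (in_quot s * x).
Proof.
move=> AM [n [a [b [Aa Bb ->]]]].
exists n, (fun i => in_quot s * a i), b; split=> // [i|]; first exact: AM.
by rewrite mulr_sumr; apply: eq_bigr => i _; rewrite mulrA.
Qed.

(** An inverse of the ideal of [a] and [b] expresses [1] with just two terms:
    the coefficients of [a] in a sum of products can be collected. *)
Lemma pair_ideal_mul a b B x :
  is_fractional_ideal B ->
  frac_ideal_mul (@in_quot S @` pair_ideal a b) B x ->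
  exists k l, [/\ B k, B l & x = in_quot a * k + in_quot b * l].
Proof.
move=> [[y0 By0] BD BM _] [n [c [d [Ic Bd ->]]]].
have B0 : B 0 by rewrite -(mul0r y0) -in_quot0; exact: BM.
apply: (big_ind (fun x => exists k l, [/\ B k, B l & x = in_quot a * k + in_quot b * l])).
- by exists 0, 0; split; rewrite // !mulr0 addr0.
- move=> _ _ [k [l [Bk Bl ->]]] [k' [l' [Bk' Bl' ->]]].
  by exists (k + k'), (l + l'); split; [exact: BD | exact: BD | ring].
- move=> i _; have [_ [r [s ->]] <-] := Ic i.
  exists (in_quot r * d i), (in_quot s * d i); split; [exact: BM | exact: BM |].
  by rewrite in_quotD !in_quotM; ring.
Qed.

(** The largest candidate for an inverse of [I]: every fractional ideal whose
    product with [I] lies in [S] is contained in it. *)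
Definition inverse_ideal I : set Q :=
  [set x | forall a, I a -> range (@in_quot S) (in_quot a * x)].

(** Any cancellable [a] in [I] is a common denominator for the inverse ideal,
    which [a] multiplies into [S] by definition. *)
Lemma inverse_ideal_fractional I a :
  I a -> GRing.lreg a -> is_fractional_ideal (inverse_ideal I).
Proof.
move=> Ia ra; split.
- by exists 0 => b _; exists 0; rewrite // mulr0.
- move=> x y Jx Jy b Ib; have [r _ er] := Jx b Ib; have [s _ es] := Jy b Ib.
  by exists (r + s); rewrite // in_quotD er es mulrDr.
- move=> s x Jx b Ib; have [r _ er] := Jx b Ib.
  by exists (s * r); rewrite // in_quotM er; ring.
- by exists a => // _ [x Jx <-]; exact: Jx.
Qed.

Lemma mul_inverse_ideal_sub I :
  frac_ideal_mul (@in_quot S @` I) (inverse_ideal I) `<=` range (@in_quot S).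
Proof.
move=> _ [n [c [d [Ic Jd ->]]]]; apply: (big_ind (range (@in_quot S))).
- by exists 0.
- by move=> _ _ [r _ <-] [s _ <-]; exists (r + s); rewrite // in_quotD.
- by move=> i _; have [a Ia <-] := Ic i; exact: Jd.
Qed.

(** The product of [I] with its inverse ideal, pulled back to [S].  Invertibility
    of [I] becomes the statement that this ideal is not proper, which can be
    tested at the maximal ideals. *)
Lemma trace_ideal_is_ideal I a :
  is_ideal I -> I a -> GRing.lreg a ->
  is_ideal [set s | frac_ideal_mul (@in_quot S @` I) (inverse_ideal I) (in_quot s)].
Proof.
move=> idI Ia ra; have [_ _ IM _] := ideal_fractional idI.
have [[x Jx] _ _ _] := inverse_ideal_fractional Ia ra; split.
- have [s _ e] := Jx a Ia; exists s; rewrite /= e.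
  by apply: frac_ideal_mul1 => //; exists a.
- by move=> r s /= Kr Ks; rewrite in_quotD; exact: frac_ideal_mulD.
- by move=> s r /= Kr; rewrite in_quotM; exact: frac_ideal_mulZ.
Qed.


End Fractional.

(** * Prüfer semirings *)

(** With [K] inverse to the ideal of [a] and [b], the relation [1 = a k + b l]
    makes [a k] or [b l] a unit at [p], so [a] or [b] generates the ideal
    there. *)
Lemma Prufer_loc_total (S : comNzSemiRingType) (p : set S)
    (p_prime : is_prime p) (a b : S) :
  is_Prufer S ->
  loc_dvd (prime_compl p_prime) a b \/ loc_dvd (prime_compl p_prime) b a.
Proof.
move=> pru; have [idp pT _] := p_prime.
case: (pselect (pair_ideal a b = [set 0])) => [I0|In0].
  have /= -> : [set 0] b by rewrite -I0; exact: pair_ideal_r.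
  left; exists 1, 0; split; first exact: mulSet1.
  by rewrite mulr0 mul0r.
have [_ [K fK KS]] :=
  pru _ (pair_ideal_is_ideal a b) (pair_ideal_finitely_generated a b) In0.
have inS x k : pair_ideal a b x -> K k -> range (@in_quot S) (in_quot x * k).
  by move=> Ix Kk; rewrite -KS; apply: frac_ideal_mul1 => //; exists x.
have [k [l [Kk Kl e1]]] : exists k l,
    [/\ K k, K l & in_quot (1 : S) = in_quot a * k + in_quot b * l].
  by apply: pair_ideal_mul => //; rewrite KS; exists 1.
have [ak _ eak] := inS a k (pair_ideal_l a b) Kk.
have [bk _ ebk] := inS b k (pair_ideal_r a b) Kk.
have [al _ eal] := inS a l (pair_ideal_l a b) Kl.
have [bl _ ebl] := inS b l (pair_ideal_r a b) Kl.
case: (pselect (p ak)) => [pak|npak]; last first.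
  left; exists ak, bk; split=> //.
  by apply: in_quot_inj; rewrite !in_quotM eak ebk; ring.
right; exists bl, al; split; last first.
  by apply: in_quot_inj; rewrite !in_quotM ebl eal; ring.
move=> pbl; apply: pT; apply: ideal1 => //.
have -> : 1 = ak + bl by apply: in_quot_inj; rewrite in_quotD eak ebl.
by have [_ pD _] := idp; exact: pD.
Qed.

(** Invertibility is a local property: at a maximal ideal containing the product
    of [I] with its inverse ideal, [I] would be generated by one element [c],
    and a suitable multiple of [1 / c] in the inverse ideal contradicts this
    containment. *)
Lemma loc_total_Prufer (S : comNzSemiRingType) :
  is_semidomain S ->
  (forall (m : set S) (m_maximal : is_maximal m) (a b : S),
     loc_dvd (prime_compl (maximal_prime m_maximal)) a b \/
     loc_dvd (prime_compl (maximal_prime m_maximal)) b a) ->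
  is_Prufer S.
Proof.
move=> domS tot I idI [g eI] In0.
have gI x : x \in g -> I x by move=> xg; rewrite eI => K [_ /(_ x xg)].
have subI K : is_ideal K -> (forall x, x \in g -> K x) -> I `<=` K.
  by move=> idK gK; rewrite eI; apply: smallest_sub.
have [a ag a0] : exists2 a, a \in g & a != 0.
  apply: contrapT => h; apply: In0; apply/seteqP; split; last first.
    by move=> _ ->; exact: ideal0.
  apply: subI => [|x xg]; first exact: set0_is_ideal.
  by apply: contrapT => /eqP x0; apply: h; exists x.
have Ia := gI a ag; have ra := domS a a0.
split; first exact: ideal_fractional.
exists (inverse_ideal I); first exact: inverse_ideal_fractional ra.
apply/seteqP; split; first exact: mul_inverse_ideal_sub.
have idK := trace_ideal_is_ideal idI Ia ra.
set K := [set s | _] in idK.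
suff KT : K = setT by move=> _ [s _ <-]; rewrite -[_ _]/(K s) KT.
apply: contrapT => nKT; have [m mmax Km] := maximal_above idK nKT.
have [c [s [cg ms sg]]] := loc_total_generator a g (tot m mmax).
have cg' : c \in g by move: cg; rewrite inE => /orP[/eqP->|].
(* If [c] were 0, then [s * a = 0] with [a] cancellable, so that [s] would be 0
   and lie in [m]. *)
have c0 : c != 0.
  apply/eqP=> c0; have [r] := sg a (mem_head a g).
  rewrite c0 mulr0 mulrC -(mulr0 a) => /ra s0.
  by apply: (@mulSet0 _ (prime_compl (maximal_prime mmax))); rewrite -s0.
have rc := domS c c0.
pose q : total_quotient S := frac s (den (rc : mset (MC S) c)).
have mulq b r : s * b = r * c -> in_quot b * q = in_quot r.
  move=> e; rewrite fracM; apply/frac_eqP; exists 1; split; first exact: lreg1.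
  by rewrite !val_loc_denM !val_loc_den1 val_den mulr1 !mul1r mulrC e mulrC.
apply: ms; apply: Km; rewrite /K /= -(mulq c s erefl).
apply: frac_ideal_mul1; first by exists c => //; exact: gI.
(* The [b] that [q] multiplies into [S] form an ideal, so that membership of [q]
   in the inverse ideal can be checked on the generators. *)
suff : I `<=` [set b | range (@in_quot S) (in_quot b * q)] by [].
apply: subI; last first.
  by move=> b bg; have [|r /mulq e] := sg b; [rewrite inE bg orbT | exists r].
split.
- by exists 0, 0; rewrite // in_quot0 mul0r.
- move=> x y [r _ er] [t _ et]; exists (r + t) => //.
  by rewrite !in_quotD er et mulrDl.
- by move=> t x [r _ er]; exists (t * r) => //; rewrite !in_quotM er mulrA.
Qed.

Theorem theorem3p11 (S : comNzSemiRingType) (S_semidomain : is_semidomain S) :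
  [<-> is_Prufer S;
       forall (p : set S) (p_prime : is_prime p),
         is_valuation_semidomain (loc_at_prime p_prime);
       forall (m : set S) (m_maximal : is_maximal m),
         is_valuation_semidomain (loc_at_prime (maximal_prime m_maximal))].
Proof.
tfae=> [pru p p_prime|val_p m m_maximal|val_m].
- split; first exact: loc_semidomain.
  by apply/loc_ideals_totalP => a b; exact: Prufer_loc_total.
- exact: val_p.
- apply: loc_total_Prufer => // m m_maximal.
  by apply/loc_ideals_totalP; have [] := val_m m m_maximal.
Qed.
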